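(* Let $T=\{3,6\}/\Gamma$ be a polyhedral equivelar triangulated torus, with associated lattice $M$ and cone $\sigma^\vee\subseteq M_{\mathbb R}$ as in the context. Then $\sigma^\vee$ is a Gorenstein cone, and it is a Cayley cone associated to $3$ lattice polytopes.
   Context: Let $\mathbb T\subset\mathbb R^2$ be the lattice generated by $\tau_1=(1,0)$, $\tau_2=\frac12(-1,\sqrt3)$, $\tau_3=\frac12(-1,-\sqrt3)$ (so $\tau_1+\tau_2+\tau_3=0$). $\{3,6\}$ is the tessellation of $\mathbb R^2$ by equilateral triangles with vertex set $\mathbb T$ and edges $\{p,p+\tau_k\}$. Let $\Gamma\subseteq\mathbb T$ be a sublattice of index $n$, $T=\{3,6\}/\Gamma$. $T$ is assumed polyhedral: the intersection of two triangles is a common face. $G=\mathbb T/\Gamma$ acts simply transitively on $\mathrm{vert}\,T$ by translations; $\pm\tau_k(p)$ means $p\pm\tau_k$. Convention: $\{i,j,k\}=\{1,2,3\}$. $M$ is the sublattice of $\mathbb Z^3\oplus\mathbb Z^n$ (standard basis $\epsilon_1,\epsilon_2,\epsilon_3$, $e_p$ for $p\in\mathrm{vert}\,T$) generated by the $3n$ vectors $A_{p,\tau_k(p)}=\epsilon_k+e_p+e_{\tau_k(p)}-e_{-\tau_i(p)}-e_{-\tau_j(p)}$; $\sigma^\vee\subset M_{\mathbb R}=M\otimes\mathbb R$ is the cone they generate. A rational finite polyhedral cone $C\subset M_{\mathbb R}$ is Gorenstein if there is $n_C\in\mathrm{Hom}(M,\mathbb Z)$ with $\langle v,n_C\rangle=1$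 for all primitive generators $v\in M$ of rays of $C$. For lattice polytopes $\Delta_1,\dots,\Delta_r\subset\Lambda_{\mathbb R}$ ($\Lambda$ a lattice) the associated Cayley cone is $\{(\lambda_1,\dots,\lambda_r,\lambda_1x_1+\dots+\lambda_rx_r):\lambda_i\ge0,\ x_i\in\Delta_i\}\subset\mathbb R^r\oplus\Lambda_{\mathbb R}$, with lattice $\mathbb Z^r\oplus\Lambda$. *)

(* Defs.v *)
From mathcomp Require Import all_boot all_order all_algebra.
From mathcomp Require Import boolp classical_sets functions reals.

Set Implicit Arguments.
Unset Strict Implicit.
Unset Printing Implicit Defensive.
Import GRing.Theory.
Local Open Scope ring_scope.
Local Open Scope classical_set_scope.

(* A lattice L is represented by its points inside a real vector space V, and
   L_R = L (x) R by the real span of L; this is legitimate because a lattice is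
   generated by vectors that are linearly independent over R. *)
Section ConvexGeometry.
Variables (R : realType) (V : lmodType R).

Definition zspan (I : finType) (a : I -> V) : set V :=
  [set x | exists c : I -> int, x = \sum_i a i *~ c i].

Definition cone_hull (I : finType) (a : I -> V) : set V :=
  [set x | exists2 c : I -> R, (forall i, 0 <= c i) & x = \sum_i c i *: a i].

Definition conv_hull (I : finType) (a : I -> V) : set V :=
  [set x | exists c : I -> R,
     [/\ forall i, 0 <= c i, \sum_i c i = 1 & x = \sum_i c i *: a i]].

Definition is_lattice (L : set V) : Prop :=
  exists (d : nat) (b : 'I_d -> V),
    (forall c : 'I_d -> R, \sum_i c i *: b i = 0 -> forall i, c i = 0) /\
    L = zspan b.

Definition lattice_polytope (L D : set V) : Prop :=
  exists (k : nat) (a : 'I_k.+1 -> V), (forall i, L (a i)) /\ D = conv_hull a.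

Definition rational_polyhedral_cone (L C : set V) : Prop :=
  exists (k : nat) (a : 'I_k -> V), (forall i, L (a i)) /\ C = cone_hull a.

Definition cone_face (C F : set V) : Prop :=
  exists u : {scalar V},
    (forall x, C x -> 0 <= u x) /\ F = C `&` [set x | u x = 0].

Definition primitive (L : set V) (v : V) : Prop :=
  [/\ L v, v != 0 & forall (w : V) (k : nat), L w -> v = w *+ k -> k = 1%N].

Definition primitive_ray_generator (L C : set V) (v : V) : Prop :=
  primitive L v /\ cone_face C [set x | exists2 t : R, 0 <= t & x = t *: v].

(* Only the values of [f] on [L] are meaningful: [f] stands for an element of
   Hom(L, Z). *)
Definition dual_vector (L : set V) (f : V -> int) : Prop :=
  forall x y, L x -> L y -> f (x + y) = f x + f y.

Definition gorenstein_cone (L C : set V) : Prop :=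
  rational_polyhedral_cone L C /\
  exists nC : V -> int,
    dual_vector L nC /\ forall v, primitive_ray_generator L C v -> nC v = 1.

End ConvexGeometry.

Section CayleyCones.
Variable R : realType.

Definition cayley_lattice (r : nat) (V : lmodType R) (L : set V) :
    set ('rV[R]_r * V)%type :=
  [set z : ('rV[R]_r * V)%type | (exists c : 'I_r -> int, forall i, z.1 0 i = (c i)%:~R) /\ L z.2].

Definition cayley_cone (r : nat) (V : lmodType R) (D : 'I_r -> set V) :
    set ('rV[R]_r * V)%type :=
  [set z : ('rV[R]_r * V)%type | (forall i, 0 <= z.1 0 i) /\
     exists x : 'I_r -> V,
       (forall i, D i (x i)) /\ z.2 = \sum_i z.1 0 i *: x i].

(* "Being a Cayley cone" is understood up to isomorphism of lattices. The
   isomorphism, extended to a linear map of the ambient space, is [f]. *)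
Definition is_cayley_cone (V : lmodType R) (L C : set V) (r : nat) : Prop :=
  exists (d : nat) (L' : set 'rV[R]_d) (D : 'I_r -> set 'rV[R]_d)
         (f : {linear V -> ('rV[R]_r * 'rV[R]_d)%type}),
    [/\ is_lattice L',
        forall i, lattice_polytope L' (D i),
        set_bij L (cayley_lattice L') f &
        f @` C = cayley_cone D].

End CayleyCones.

Section TriangulatedTorus.
Variable R : realType.

Definition vec2 (x y : R) : 'rV[R]_2 := \row_j [:: x; y]`_j.

(* tau_1, tau_2, tau_3 are [tau 0], [tau 1], [tau 2]. *)
Definition tau (k : 'I_3) : 'rV[R]_2 :=
  [:: vec2 1 0;
      vec2 (- (1 / 2)) (Num.sqrt 3 / 2);
      vec2 (- (1 / 2)) (- (Num.sqrt 3 / 2))]`_k.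

Definition tri_lattice : set 'rV[R]_2 := zspan tau.

Definition tri_edge (p q : 'rV[R]_2) : Prop :=
  exists k, q = p + tau k \/ p = q + tau k.

(* The triangles of {3,6} are the convex hulls of three pairwise adjacent
   vertices. *)
Definition tri_triangle (w : 'I_3 -> 'rV[R]_2) : Prop :=
  (forall i, tri_lattice (w i)) /\
  (forall i j, i != j -> tri_edge (w i) (w j)).

(* The face of the triangle [w] with vertices indexed by [s]; it is the empty
   face when [s] is empty. *)
Definition tri_face (w : 'I_3 -> 'rV[R]_2) (s : {set 'I_3}) : set 'rV[R]_2 :=
  conv_hull (fun i : {i | i \in s} => w (val i)).

Variable Gamma : zmodClosed 'rV[R]_2.

(* The underlying space R^2 / Gamma, with its group structure. *)
Definition torus := {ideal_quot Gamma}.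

Definition to_torus (x : 'rV[R]_2) : torus := (\pi_({ideal_quot Gamma}) x)%qT.

Definition torus_vertices : set torus := to_torus @` tri_lattice.

(* In R^2 / Gamma, the intersection of two triangles of {3,6} / Gamma is a
   (possibly empty) face of both of them. *)
Definition polyhedral : Prop :=
  forall w w' : 'I_3 -> 'rV[R]_2, tri_triangle w -> tri_triangle w' ->
  exists s s' : {set 'I_3},
    (to_torus @` conv_hull w) `&` (to_torus @` conv_hull w')
      = to_torus @` tri_face w s /\
    to_torus @` tri_face w s = to_torus @` tri_face w' s'.

(* [vtx] lists the vertices of the torus; it labels the standard basis of the
   summand Z^n of Z^3 (+) Z^n. *)
Variables (n : nat) (vtx : 'I_n -> torus).

Definition basis_eps (k : 'I_3) : ('rV[R]_3 * 'rV[R]_n)%type := (delta_mx 0 k, 0).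

Definition basis_e (p : torus) : ('rV[R]_3 * 'rV[R]_n)%type :=
  (0, \row_i (vtx i == p)%:R).

(* A_{p, tau_k(p)} *)
Definition gen_A (p : torus) (k : 'I_3) : ('rV[R]_3 * 'rV[R]_n)%type :=
  basis_eps k + basis_e p + basis_e (p + to_torus (tau k))
  - \sum_(i < 3 | i != k) basis_e (p - to_torus (tau i)).

Definition gens_A (pk : ('I_n * 'I_3)%type) : ('rV[R]_3 * 'rV[R]_n)%type :=
  gen_A (vtx pk.1) pk.2.

Definition latticeM : set ('rV[R]_3 * 'rV[R]_n)%type := zspan gens_A.

Definition sigma_dual : set ('rV[R]_3 * 'rV[R]_n)%type := cone_hull gens_A.

End TriangulatedTorus.

Arguments torus_vertices {R} Gamma _.

(* Main.v *)
(** The sum of the three [eps]-coordinates equals 1 on every generator of the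
    cone, hence it is the integral functional required for the Gorenstein
    property.  The projection of [M] to [Z^3] sends [A_(p,k)] to [eps_k], so
    after fixing a vertex [p0] the lattice splits as [Z^3 (+) L'], with [L']
    generated by the differences [A_(p,k) - A_(p0,k)], and the cone becomes the
    Cayley cone of the polytopes [conv {A_(p,k) - A_(p0,k) | p}]. *)
Require Import Defs.
From HB Require Import structures.
From mathcomp Require Import all_boot all_order all_algebra.
From mathcomp Require Import boolp classical_sets functions reals.

Set Implicit Arguments.
Unset Strict Implicit.
Unset Printing Implicit Defensive.
Import Order.TTheory GRing.Theory Num.Theory.
Local Open Scope ring_scope.
Local Open Scope classical_set_scope.

(** * Integral spans, cone hulls and a Gorenstein criterion *)

Section Spans.
Variables (R : realType) (V : lmodType R) (I : finType) (a : I -> V).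

Lemma zspan_gen i : zspan a (a i).
Proof.
exists (fun j => (j == i)%:Z); rewrite (bigD1 i) //= eqxx mulr1z big1 ?addr0 //.
by move=> j /negbTE ->; rewrite mulr0z.
Qed.

Lemma cone_hull_reindex (J : finType) (h : J -> I) :
  bijective h -> cone_hull (a \o h) = cone_hull a.
Proof.
move=> [h' hK h'K]; apply/seteqP; split => x /= [c c0 ->].
- exists (c \o h') => [i|]; first exact: c0.
  rewrite [RHS](reindex h) /=; last by exists h' => ? _.
  by apply: eq_bigr => j _; rewrite hK.
- exists (c \o h) => [i|]; first exact: c0.
  by rewrite (reindex h) //=; exists h' => ? _.
Qed.

(** A primitive ray generator [v] is a nonnegative combination of the [a i], and the functional
    cutting out its ray kills every term, so some [a i] lies on the ray. Integrality of [u] on the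
    span and primitivity then give [v = a i]. *)
Lemma gorenstein_cone_hull (u : {scalar V}) :
  (forall i, u (a i) = 1) -> gorenstein_cone (zspan a) (cone_hull a).
Proof.
move=> ua; have uint x : zspan a x -> exists m : int, u x = m%:~R.
  move=> [c ->]; exists (\sum_i c i); rewrite raddf_sum rmorph_sum /=.
  by apply: eq_bigr => i _; rewrite raddfMz /= ua.
split.
  exists #|I|, (a \o enum_val); split=> [i|]; first exact: zspan_gen.
  by rewrite cone_hull_reindex//; apply: enum_val_bij.
(* On the span [u] is integer-valued, so the floor is exact there and only turns [u] into a map to
   [int]. *)
exists (fun x => Num.floor (u x)); split.
  move=> x y /uint[m mE] /uint[m' m'E].
  by rewrite raddfD /= mE m'E -rmorphD /= !intrKfloor.
move=> v [[Lv v0 vprim] [w [w0 rayE]]].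
have : [set x | exists2 t : R, 0 <= t & x = t *: v] v by exists 1; rewrite ?scale1r.
rewrite rayE => -[[c c0 vE] /= wv].
have aC i : cone_hull a (a i).
  exists (fun j => (j == i)%:R) => [j|]; first exact: ler0n.
  rewrite (bigD1 i) //= eqxx scale1r big1 ?addr0 //.
  by move=> j /negbTE ->; rewrite scale0r.
(* [w v = 0] is a sum of nonnegative terms. *)
have cw i : c i * w (a i) = 0.
  move: wv; rewrite vE raddf_sum /=.
  under eq_bigr do rewrite linearZ /=.
  move/eqP; rewrite psumr_eq0 => [/allP/(_ i)|j _]; last exact/mulr_ge0/w0/aC.
  by rewrite mem_index_enum => /(_ isT)/eqP.
have [i ci] : exists i, c i != 0.
  apply/not_existsP => cz; case/eqP: v0; rewrite vE big1 // => i _.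
  by have /negP/negPn/eqP -> := cz i; rewrite scale0r.
have wai : w (a i) = 0 by move/eqP: (cw i); rewrite mulf_eq0 (negbTE ci) => /eqP.
have [t t0 aiE] : [set x | exists2 t : R, 0 <= t & x = t *: v] (a i).
  by rewrite rayE; split => //; exact: aC.
have [m mE] := uint _ Lv.
have tm : t * m%:~R = 1 by rewrite -mE -(ua i) aiE linearZ.
(* Primitivity speaks of natural multiples; [t * m = 1] with [0 <= t] excludes negative [m]. *)
have m0 : 0 <= m.
  rewrite -(ler0z R) leNgt; apply/negP => mneg.
  by have := mulr_ge0_le0 t0 (ltW mneg); rewrite tm ler10.
have vai : v = a i *+ `|m|%N.
  rewrite aiE -scaler_nat natr_absz ger0_norm // scalerA mulrC tm scale1r //.
rewrite mE intrKfloor -(gez0_abs m0).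
by rewrite (vprim _ _ (zspan_gen i) vai).
Qed.

End Spans.

(** * Finitely many integer vectors generate a lattice *)

Lemma zspan_rows (R : realType) (m d : nat) (A : 'M[int]_(m, d)) :
  zspan (fun i => map_mx (intr : int -> R) (row i A)) =
  [set x | exists u : 'rV[int]_m, x = map_mx intr (u *m A)].
Proof.
have mapE (u : 'rV[int]_m) :
    map_mx intr (u *m A) = \sum_i map_mx (intr : int -> R) (row i A) *~ u 0 i.
  rewrite mulmx_sum_row raddf_sum; apply: eq_bigr => i _ /=.
  by apply/rowP => j; rewrite -scaler_int !mxE intrM.
apply/seteqP; split => x /= [c ->].
- by exists (\row_i c i); rewrite mapE; apply: eq_bigr => i _; rewrite mxE.
- by exists (fun i => c 0 i).
Qed.

(** In the Smith form [A = P D Q] with [P], [Q] unimodular, [A] and [D Q] have the same integral row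
    span; a basis consists of the rows of [Q] with nonzero diagonal entry, scaled by that entry. *)
Lemma is_lattice_zspan_int (R : realType) (m d : nat) (A : 'M[int]_(m, d)) :
  is_lattice (zspan (fun i => map_mx (intr : int -> R) (row i A))).
Proof.
have [P Pu [Q Qu [s _ AE]]] := int_Smith_normal_form A.
(* [D] has no row [j] when [m <= j], whatever [s] contains there. *)
pose e (j : 'I_d) : int := if (j < m)%N then s`_j else 0.
pose J := [set j | e j != 0]%SET.
pose b (k : 'I_#|J|) : 'rV[R]_d := map_mx intr (e (enum_val k) *: row (enum_val k) Q).
(* Coefficients on [J] extend by 0 to all of ['I_d], so that combinations of the [b k] become
   products with [Q]. *)
have ext (T : zmodType) (c : 'I_#|J| -> T) : exists c', forall k, c' (enum_val k) = c k.
  exists (fun j => if [pick k | enum_val k == j] is Some k then c k else 0) => k.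
  by case: pickP => [k' /eqP/enum_val_inj -> //|/(_ k)]; rewrite eqxx.
have bE (c : 'I_d -> R) : \sum_k c (enum_val k) *: b k
    = (\row_j (c j * (e j)%:~R)) *m map_mx intr Q.
  rewrite mulmx_sum_row (bigID (mem J)) /= [X in _ + X]big1 ?addr0; last first.
    by move=> j; rewrite inE negbK mxE => /eqP ->; rewrite mulr0 scale0r.
  rewrite [RHS]big_enum_val /=; apply: eq_bigr => k _.
  by apply/rowP => j; rewrite !mxE intrM mulrA.
have QuR : map_mx (intr : int -> R) Q \in unitmx.
  by rewrite unitmxE det_map_mx rmorph_unit // -unitmxE.
exists #|J|, b; split.
  move=> c; have [c' c'E] := ext _ c.
  under eq_bigr do rewrite -c'E.
  rewrite bE => /(congr1 (mulmx^~ (invmx (map_mx intr Q)))).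
  rewrite mulmxK // mul0mx => /rowP cz k; have := cz (enum_val k).
  rewrite !mxE c'E => /eqP; rewrite mulf_eq0 intr_eq0.
  by have := enum_valP k; rewrite inE => /negbTE ->; rewrite orbF => /eqP.
have DE (v : 'rV[int]_m) :
    v *m \matrix_(i, j) (s`_i *+ (i == j :> nat)) =
    \row_(j < d) ((if insub (j : nat) is Some i then v 0 i else 0) * e j).
  apply/rowP => j; rewrite !mxE /e; case: insubP => [i jm ij|/negbTE jm].
    rewrite jm (bigD1 i) //= mxE ij eqxx mulr1n big1 ?addr0 // => i'.
    by rewrite mxE -val_eqE /= ij => /negbTE ->; rewrite mulr0n mulr0.
  rewrite mul0r big1 // => i _; rewrite mxE.
  by case: eqP => [ij|]; [rewrite -ij ltn_ord in jm|rewrite mulr0n mulr0].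
have bZE (c : 'I_d -> int) : \sum_k b k *~ c (enum_val k)
    = map_mx intr ((\row_j (c j * e j)) *m Q).
  under eq_bigr do rewrite -scaler_int.
  rewrite (bE (fun j => (c j)%:~R)) map_mxM; congr (_ *m _).
  by apply/rowP => j; rewrite !mxE rmorphM.
rewrite zspan_rows AE; apply/seteqP; split => x /=.
- move=> [u ->]; rewrite !mulmxA DE -bZE.
  by exists (fun k => if insub (val (enum_val k)) is Some i then (u *m P) 0 i else 0).
- move=> [c ->]; have [c' c'E] := ext _ c.
  under eq_bigr do rewrite -c'E.
  (* The row [c'] is cut or padded with zeros to length [m], then [P] is undone over the
     integers. *)
  exists ((\row_i if insub (val i) is Some j then c' j else 0) *m invmx P).
  rewrite !mulmxA mulmxKV // DE bZE; congr (map_mx _ (_ *m _)).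
  apply/rowP => j; rewrite !mxE /e; case: insubP => [i jm ij|/negbTE ->].
    by rewrite mxE ij valK.
  by rewrite !mulr0.
Qed.

(** * The linear maps behind the splitting *)

Section CayleySplitting.
Variables (R : realType) (r d : nat).

Definition coord_sum (x : ('rV[R]_r * 'rV[R]_d)%type) : R^o := \sum_k x.1 0 k.

Lemma coord_sum_is_linear : linear coord_sum.
Proof.
move=> c x y; rewrite /coord_sum scaler_sumr -big_split /=.
by apply: eq_bigr => k _; rewrite !mxE.
Qed.
HB.instance Definition _ :=
  GRing.isLinear.Build R ('rV[R]_r * 'rV[R]_d)%type R^o *:%R coord_sum coord_sum_is_linear.

(** The change of coordinates that moves each base point [(delta_mx 0 k, s k)] to
    [(delta_mx 0 k, 0)]. *)
Definition shear (s : 'I_r -> 'rV[R]_d) (x : ('rV[R]_r * 'rV[R]_d)%type) :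
  ('rV[R]_r * 'rV[R]_d)%type := (x.1, x.2 - \sum_k x.1 0 k *: s k).

Variable s : 'I_r -> 'rV[R]_d.

Lemma shear_is_linear : linear (shear s).
Proof.
move=> c x y; congr pair => /=.
rewrite scalerBr scaler_sumr addrACA -opprD -big_split /=; congr (_ - _).
by apply: eq_bigr => k _; rewrite !mxE scalerDl scalerA.
Qed.
HB.instance Definition _ :=
  GRing.isLinear.Build R ('rV[R]_r * 'rV[R]_d)%type ('rV[R]_r * 'rV[R]_d)%type
    *:%R (shear s) shear_is_linear.

Lemma shear_inj : injective (shear s).
Proof. by move=> [x1 x2] [y1 y2] [/= <- /addIr <-]. Qed.

End CayleySplitting.

(** * Cones whose generators project to standard basis vectors *)

Section CayleyHull.
Variables (R : realType) (r d m : nat).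
Variable a : 'I_m.+1 * 'I_r -> ('rV[R]_r * 'rV[R]_d)%type.
Hypothesis a1 : forall pk, (a pk).1 = delta_mx 0 pk.2.

Lemma gorenstein_cayley_hull : gorenstein_cone (zspan a) (cone_hull a).
Proof.
apply: (@gorenstein_cone_hull _ _ _ _ (@coord_sum R r d)) => pk.
rewrite /= /coord_sum a1 (bigD1 pk.2) //= mxE !eqxx big1 ?addr0 // => k.
by rewrite mxE => /negbTE ->.
Qed.

Hypothesis a2 : forall pk, exists z : 'rV[int]_d, (a pk).2 = map_mx intr z.

(** The index [ord0] plays the role of the vertex [p0]. *)
Let s k := (a (ord0, k)).2.
Let g pk := (a pk).2 - s pk.2.
Let L' := zspan g.

Let shear_a pk : shear s (a pk) = (delta_mx 0 pk.2, g pk).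
Proof.
rewrite /shear a1 (bigD1 pk.2) //= mxE !eqxx scale1r big1 ?addr0 // => k.
by rewrite mxE => /negbTE ->; rewrite scale0r.
Qed.

Let g0 k : g (ord0, k) = 0. Proof. exact: subrr. Qed.

(** The differences [g pk] are integer vectors, hence the rows of an integer matrix. *)
Let is_lattice_L' : is_lattice L'.
Proof.
have /choice[z zE] := a2.
pose A := \matrix_(i < #|{: 'I_m.+1 * 'I_r}|) (z (enum_val i) - z (ord0, (enum_val i).2)).
suff -> : L' = zspan (fun i => map_mx (intr : int -> R) (row i A)).
  exact: is_lattice_zspan_int.
have gE pk : g pk = map_mx intr (row (enum_rank pk) A).
  by rewrite rowK enum_rankK map_mxB -!zE.
apply/seteqP; split => x /= [c ->].
- exists (c \o enum_val); rewrite [RHS](reindex enum_rank) /=; last first.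
    by exists enum_val => ? _; rewrite ?enum_valK ?enum_rankK.
  by apply: eq_bigr => pk _; rewrite gE enum_rankK.
- exists (c \o enum_rank).
  rewrite (reindex enum_rank) /=; last first.
    by exists enum_val => ? _; rewrite ?enum_valK ?enum_rankK.
  by apply: eq_bigr => pk _; rewrite gE.
Qed.

(** The first component records the total weight of each [k], the second the points of the
    polytopes; integral and nonnegative [c] give the lattice and cone comparisons. *)
Let shear_comb (c : 'I_m.+1 * 'I_r -> R) :
  shear s (\sum_pk c pk *: a pk) =
  (\row_k \sum_p c (p, k), \sum_k \sum_p c (p, k) *: g (p, k)).
Proof.
rewrite raddf_sum /=.
under eq_bigr do rewrite linearZ /= shear_a.
rewrite [LHS]surjective_pairing; congr pair; last first.
  rewrite raddf_sum /= exchange_big pair_big /=.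
  by apply: eq_bigr => -[].
apply/rowP => k; rewrite raddf_sum summxE !mxE.
transitivity (\sum_p \sum_k' c (p, k') * (k' == k)%:R).
  by rewrite pair_big /=; apply: eq_bigr => -[p k'] _; rewrite !mxE eqxx eq_sym.
apply: eq_bigr => p _; rewrite (bigD1 k) //= eqxx mulr1 big1 ?addr0 // => k'.
by move=> /negbTE ->; rewrite mulr0.
Qed.

Lemma is_cayley_cone_hull : is_cayley_cone (zspan a) (cone_hull a) r.
Proof.
have intE (c : 'I_m.+1 * 'I_r -> int) :
    \sum_pk a pk *~ c pk = \sum_pk (c pk)%:~R *: a pk.
  by apply: eq_bigr => pk _; rewrite scaler_int.
exists d, L', (fun k => conv_hull (fun p => g (p, k))), (shear s); split.
- exact: is_lattice_L'.
- by move=> k; exists m, (fun p => g (p, k)); split=> // p; exact: zspan_gen.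
- split.
  + move=> _ /= [c ->]; rewrite intE shear_comb; split => /=.
      by exists (fun k => \sum_p c (p, k)) => k; rewrite mxE rmorph_sum.
    exists c; rewrite exchange_big pair_big /=.
    by apply: eq_bigr => -[p k] _; rewrite scaler_int.
  + by move=> x y _ _; exact: shear_inj.
  + move=> [y1 y2] /= [[z /= zE] [c y2E]].
    (* Since [g (ord0, k) = 0], the coefficient at [ord0] is free: it is adjusted to make the total
       weight [z k] without moving the second component. *)
    pose t pk := c pk + (if pk.1 == ord0 then z pk.2 - \sum_p c (p, pk.2) else 0).
    exists (\sum_pk a pk *~ t pk); first by exists t.
    rewrite intE shear_comb; congr pair.
      apply/rowP => k; rewrite mxE zE -rmorph_sum; congr (_%:~R).
      by rewrite /t big_split /= -big_mkcond big_pred1_eq addrC subrK.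
    rewrite y2E exchange_big pair_big /=; apply: eq_bigr => -[p k] _.
    rewrite /t /=; case: eqP => [->|_]; last by rewrite addr0 scaler_int.
    by rewrite g0 scaler0 mul0rz.
- apply/seteqP; split => [_ /= [x [c c0 ->] <-]|[y1 y2] /= [y1_ge0 [x [xP /= y2E]]]].
    rewrite shear_comb; split => [k|] /=; first by rewrite mxE sumr_ge0.
    pose w k := \sum_p c (p, k).
    (* Where the weight [w k] vanishes, the point of the polytope is arbitrary. *)
    pose t p k := if w k == 0 then (p == ord0)%:R else c (p, k) / w k.
    have w0 k : 0 <= w k by rewrite sumr_ge0.
    exists (fun k => \sum_p t p k *: g (p, k)); split.
      move=> k; exists (t^~ k); split => // [p|]; rewrite /t; case: eqP => wk.
      * exact: ler0n.
      * by rewrite divr_ge0.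
      * by rewrite (bigD1 ord0) //= big1 ?addr0 // => p /negbTE ->.
      * by rewrite -mulr_suml divff //; exact/eqP.
    apply: eq_bigr => k _; rewrite mxE -/(w k) scaler_sumr.
    apply: eq_bigr => p _; rewrite scalerA /t; case: eqP => [wk|/eqP wk].
      (* A zero sum of nonnegative weights makes every [c (p, k)] vanish. *)
      rewrite wk mul0r; move/eqP: wk; rewrite psumr_eq0 // => /allP/(_ p).
      by rewrite mem_index_enum => /(_ isT)/eqP ->.
    by rewrite mulrC divfK.
  have /choice[c cP] : forall k, exists c : 'I_m.+1 -> R,
    [/\ forall i, 0 <= c i, \sum_i c i = 1 & x k = \sum_i c i *: g (i, k)] := xP.
  (* Each weight [y1 0 k] is distributed according to the barycentric coordinates of [x k]. *)
  exists (\sum_pk (y1 0 pk.2 * c pk.2 pk.1) *: a pk).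
    by exists (fun pk => y1 0 pk.2 * c pk.2 pk.1) => // pk; rewrite mulr_ge0 //; case: (cP pk.2).
  rewrite shear_comb y2E; congr pair.
    by apply/rowP => k; rewrite mxE /= -mulr_sumr; case: (cP k) => _ -> _; rewrite mulr1.
  apply: eq_bigr => k _; case: (cP k) => _ _ ->.
  by rewrite scaler_sumr; apply: eq_bigr => p _; rewrite scalerA.
Qed.

End CayleyHull.

(** * The generators [A_(p,k)] of the torus *)

Section TorusGenerators.
Variables (R : realType) (Gamma : zmodClosed 'rV[R]_2).
Variables (n : nat) (vtx : 'I_n -> torus Gamma).

Lemma gen_A1 p k : (gen_A vtx p k).1 = delta_mx 0 k.
Proof. by rewrite /gen_A raddfB raddf_sum /= big1 // subr0 !addr0. Qed.

Lemma gen_A2_int p k :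
  exists z : 'rV[int]_n, (gen_A vtx p k).2 = map_mx intr z.
Proof.
pose e q : 'rV[int]_n := \row_i (vtx i == q)%:Z.
have eE q : (basis_e vtx q).2 = map_mx intr (e q) by apply/rowP => i; rewrite !mxE.
exists (e p + e (p + to_torus Gamma (tau R k))
  - \sum_(i < 3 | i != k) e (p - to_torus Gamma (tau R i))).
rewrite map_mxB map_mxD -!eE /gen_A raddfB; congr (_ - _); first by rewrite /= add0r.
by rewrite !raddf_sum; apply: eq_bigr => i _; exact: eE.
Qed.

End TorusGenerators.

Theorem proposition4p13 (R : realType) (Gamma : zmodClosed 'rV[R]_2)
  (Gamma_sub : forall x : 'rV[R]_2, x \in Gamma -> tri_lattice x)
  (n : nat) (vtx : 'I_n -> torus Gamma)
  (vtx_bij : set_bij [set: 'I_n]%classic (torus_vertices Gamma) vtx)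
  (T_polyhedral : polyhedral Gamma) :
  gorenstein_cone (latticeM vtx) (sigma_dual vtx) /\
  is_cayley_cone (latticeM vtx) (sigma_dual vtx) 3.
Proof.
(* The class of the origin is a vertex, so a base vertex exists. *)
have [m nE] : exists m, n = m.+1.
  have [_ _ /(_ (to_torus Gamma 0))] := vtx_bij.
  case; first by exists 0 => //; exists (fun=> 0); rewrite big1 // => i _; rewrite mulr0z.
  by move=> i _ _; exists n.-1; rewrite prednK ?(leq_ltn_trans _ (ltn_ord i)).
subst n.
have A1 (pk : 'I_m.+1 * 'I_3) : (gens_A vtx pk).1 = delta_mx 0 pk.2 by exact: gen_A1.
split; first exact: gorenstein_cayley_hull.
by apply: is_cayley_cone_hull => // pk; exact: gen_A2_int.
Qed.
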